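(* Let $n\ge 1$. Let $B_n$ be the set of standard domino tableaux with $n$ dominoes whose shape has at most two rows, and let $D_n$ be the set of $n$-step rightward diagonal lattice walks. For $T\in B_n$ let $S_T\subseteq\{1,\dots,n\}$ be the set of labels of dominoes lying horizontally in the first row of $T$, and let $\phi(T)\in D_n$ be the walk whose step number $n+1-s$ (for $s=1,\dots,n$) is an up step if $s\in S_T$ and a down step otherwise. Then $\phi:B_n\to D_n$ is a bijection, and for every $T\in B_n$: (1) $T$ has exactly $k$ horizontal dominoes in its first row if and only if $\phi(T)$ has exactly $k$ up steps; (2) all columns of $T$ have the same size if and only if $\phi(T)$ has height $0$; (3) $T$ has shape $(n+k,n-k)$ if and only if $\phi(T)$ has height $k$.
   Context: A standard domino tableau with $n$ dominoes is a tiling of an upper-left-justified Young diagram of a partition of $2n$ by $n$ dominoes ($1\times2$ horizontal or $2\times1$ vertical), labeled bijectively by $1,\dots,n$ so that labels increase along rows (left to right) and down columns (top to bottom). Elements of $B_n$ have shapes $(n+k,n-k)$, $0\le k\le n$. An $n$-step rightward diagonal lattice walk starts at the origin and takes $n$ steps, each either an up step $+(1,1)$ or a down step $+(1,-1)$. The height of such a walk is the maximum vertical coordinate among its vertices (including the starting point at the origin), so heights are nonnegative.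
   Formalization: Item (2) is proved as ''T has exactly two rows and all its columns have the same size if and only if the walk has height 0''; as worded it fails for the one-row tableau of shape (2n), whose columns all have size 1 while its walk has height n. *)

(* Defs.v *)
From HB Require Import structures.
From mathcomp Require Import all_boot all_order all_algebra.
Set Implicit Arguments. Unset Strict Implicit. Unset Printing Implicit Defensive.
Import Order.TTheory GRing.Theory Num.Theory.

(* Cells are pairs (row, column), both counted from 0, row 0 being the top. *)
Definition cell := (nat * nat)%type.

(* A partition is the weakly decreasing sequence of its nonzero parts. *)
Definition is_partition_of (m : nat) (la : seq nat) : bool :=
  [&& sorted geq la, 0 \notin la & sumn la == m].

Definition diagram (la : seq nat) : seq cell :=
  [seq (i, j) | i <- iota 0 (size la), j <- iota 0 (nth 0 la i)].

Definition column_size (la : seq nat) (j : nat) : nat :=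
  count (fun r => j < r) la.

(* The arguments are the row and column of the leftmost, resp. topmost, cell. *)
Inductive domino := Horizontal of nat & nat | Vertical of nat & nat.

Definition domino_cells (d : domino) : seq cell :=
  match d with
  | Horizontal i j => [:: (i, j); (i, j.+1)]
  | Vertical i j => [:: (i, j); (i.+1, j)]
  end.

Definition horizontal_in_first_row (d : domino) : bool :=
  if d is Horizontal 0 _ then true else false.

(* The label s in {1, ..., n} is represented by the ordinal s - 1 : 'I_n, and a
   labeled set of dominoes by the function sending a label to its domino. *)
Definition tiles (n : nat) (la : seq nat) (f : {ffun 'I_n -> domino}) : bool :=
  perm_eq (flatten [seq domino_cells (f s) | s <- enum 'I_n]) (diagram la).

Definition weakly_before (c d : cell) : bool :=
  ((c.1 == d.1) && (c.2 <= d.2)) || ((c.2 == d.2) && (c.1 <= d.1)).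

(* The inequality is weak because both cells of a domino carry its label;
   different dominoes have different labels, so it is strict between them. *)
Definition labels_increase (n : nat) (f : {ffun 'I_n -> domino}) : bool :=
  [forall s : 'I_n, forall t : 'I_n,
     allrel (fun c d => weakly_before c d ==> (s <= t))
            (domino_cells (f s)) (domino_cells (f t))].

Record domino_tableau (n : nat) := DominoTableau {
  tableau_shape : seq nat;
  domino_of : {ffun 'I_n -> domino};
  _ : is_partition_of (2 * n) tableau_shape;
  _ : tiles tableau_shape domino_of;
  _ : labels_increase domino_of
}.

Definition B (n : nat) := {T : domino_tableau n | size (tableau_shape T) <= 2}.

Definition has_shape (n : nat) (T : B n) (a b : nat) : Prop :=
  tableau_shape (sval T) = [seq r <- [:: a; b] | 0 < r].

Definition has_two_rows (n : nat) (T : B n) : Prop :=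
  size (tableau_shape (sval T)) = 2.

Definition equal_columns (n : nat) (T : B n) : Prop :=
  forall j j' : nat,
    j < head 0 (tableau_shape (sval T)) -> j' < head 0 (tableau_shape (sval T)) ->
    column_size (tableau_shape (sval T)) j = column_size (tableau_shape (sval T)) j'.

Definition first_row_labels (n : nat) (T : B n) : {set 'I_n} :=
  [set s | horizontal_in_first_row (domino_of (sval T) s)].

Inductive step := Up | Down.

Definition is_up (s : step) : bool := if s is Up then true else false.

Definition step_vector (s : step) : int * int :=
  if s is Up then (1, 1)%R else (1, -1)%R.

(* A walk is given by its steps; step number j is the entry of index j - 1. *)
Definition D (n : nat) := n.-tuple step.

Definition vertex (n : nat) (w : D n) (j : nat) : int * int :=
  (\sum_(s <- take j w) step_vector s)%R.

(* The starting value 0 of the maximum is the ordinate of vertex w 0. *)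
Definition height (n : nat) (w : D n) : int :=
  (\big[Num.max/0]_(j < n.+1) (vertex w j).2)%R.

(* With both labels and steps shifted down by 1, the correspondence between the
   label s and the step number n + 1 - s is rev_ord : i |-> n - 1 - i. *)
Definition phi (n : nat) (T : B n) : D n :=
  [tuple if rev_ord j \in first_row_labels T then Up else Down | j < n].

(* Main.v *)
(** Reading the labels in increasing order, the cells labelled by the first [s]
    labels form a diagram of shape [(s + k, s - k)].  The next domino either goes
    horizontally into the first row, and then [k] grows by one, or its position
    is forced: vertical when [k = 0], horizontal in the second row when [k > 0],
    so that [k] becomes [k - 1] truncated at [0].  Hence every subset of the
    labels occurs as the set of labels of horizontal dominoes in the first row
    of exactly one tableau.  The recursion for [k], read from the last label
    down, is the one satisfied by the maximum of a walk when a step is prepended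
    to it: that maximum is [max(0, step + max of the rest)]. *)
Require Import Defs.
From HB Require Import structures.
From mathcomp Require Import all_boot all_order all_algebra.
From mathcomp Require Import zify.
Set Implicit Arguments. Unset Strict Implicit. Unset Printing Implicit Defensive.
Import Order.TTheory GRing.Theory Num.Theory.

(** * Cells, tilings and labels *)

Lemma mem_diagram (la : seq nat) (i j : nat) :
  ((i, j) \in diagram la) = (j < nth 0 la i).
Proof.
apply/allpairsPdep/idP => [[x [y [_ + [-> ->]]]]|lt_j]; first by rewrite mem_iota.
exists i, j; rewrite !mem_iota /= !add0n; split=> //.
by rewrite ltnNge; apply: contraL lt_j => /(nth_default 0) ->.
Qed.

Lemma diagram_uniq (la : seq nat) : uniq (diagram la).
Proof.
apply: allpairs_uniq_dep => [|i _|]; rewrite ?iota_uniq //.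
by move=> [x1 y1] [x2 y2] _ _ /= [-> ->].
Qed.

Lemma domino_cells_uniq (d : domino) : uniq (domino_cells d).
Proof. by case: d => i j; rewrite /= inE xpair_eqE; lia. Qed.

Lemma count_mem_tiling (n : nat) (f : 'I_n -> domino) (c : cell) :
  count_mem c (flatten [seq domino_cells (f s) | s <- enum 'I_n]) =
  \sum_(s < n) (c \in domino_cells (f s)).
Proof.
rewrite count_flatten sumnE 2!big_map big_enum.
by apply: eq_bigr => s _; rewrite count_uniq_mem ?domino_cells_uniq.
Qed.

Lemma tiles_cover (n : nat) (la : seq nat) (f : {ffun 'I_n -> domino}) (i j : nat) :
  tiles la f ->
  reflect (exists s, (i, j) \in domino_cells (f s)) (j < nth 0 la i).
Proof.
move=> /perm_mem tl; rewrite -mem_diagram -tl.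
apply: (iffP flatten_mapP) => [[s _ ?]|[s ?]]; exists s => //.
by rewrite mem_enum.
Qed.

(** A cell of two distinct dominoes would be counted twice in the tiling, while the diagram lists
    each cell at most once. *)
Lemma tiles_disjoint (n : nat) (la : seq nat) (f : {ffun 'I_n -> domino})
    (c : cell) (s t : 'I_n) :
  tiles la f -> c \in domino_cells (f s) -> c \in domino_cells (f t) -> s = t.
Proof.
move=> /permP/(_ (pred1 c)); rewrite count_mem_tiling => tl cs ct.
apply/eqP; apply: contraT => neq_st.
have := leq_b1 (c \in diagram la).
rewrite -(count_uniq_mem _ (diagram_uniq la)) -tl (bigD1 s) //= (bigD1 t) 1?eq_sym //=.
by rewrite cs ct.
Qed.

Lemma labels_increaseP (n : nat) (f : {ffun 'I_n -> domino}) :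
  reflect (forall s t c d, c \in domino_cells (f s) -> d \in domino_cells (f t) ->
             weakly_before c d -> s <= t)
          (labels_increase f).
Proof.
apply: (iffP forallP) => [h s t c d cs dt cd|h s].
  by move/forallP/(_ t)/allrelP/(_ c d cs dt)/implyP: (h s); apply.
by apply/forallP => t; apply/allrelP => c d cs dt; apply/implyP; apply: h.
Qed.

Lemma two_row_shapeE (m : nat) (la : seq nat) :
  is_partition_of m la -> size la <= 2 ->
  la = [seq r <- [:: nth 0 la 0; nth 0 la 1] | 0 < r].
Proof. by case: la => [|[|a] [|[|b] []]] // /and3P[]. Qed.

(** * Growing a tableau from a prescribed set [u] of first-row labels *)

Section Growth.
Variable u : nat -> bool.

Fixpoint surplus (s : nat) : nat :=
  if s is t.+1 then if u t then (surplus t).+1 else (surplus t).-1 else 0.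

Definition domino_at (s : nat) : domino :=
  if u s then Horizontal 0 (s + surplus s)
  else if surplus s == 0 then Vertical 0 s
  else Horizontal 1 (s - surplus s).

(** The labels below [s] fill row [i] up to this column; the value 0 below row 1 keeps later
    statements uniform in [i]. *)
Definition row_end (i s : nat) : nat :=
  match i with 0 => s + surplus s | 1 => s - surplus s | _ => 0 end.

Definition growth_shape (s : nat) : seq nat :=
  [seq r <- [:: s + surplus s; s - surplus s] | 0 < r].

Lemma surplus_le (s : nat) : surplus s <= s.
Proof. by elim: s => //= s IHs; case: (u s); lia. Qed.

Lemma row_endS (i s : nat) : row_end i s <= row_end i s.+1.
Proof. by case: i => [|[]] //=; case: (u s); lia. Qed.

Lemma row_end_mono (i s t : nat) : s <= t -> row_end i s <= row_end i t.
Proof.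
by move: s t; apply: (homo_leq leqnn leq_trans) => s; apply: row_endS.
Qed.

Lemma row_end_anti (i j s : nat) : i <= j -> row_end j s <= row_end i s.
Proof. by case: i j => [|[|i]] [|[|j]] //=; lia. Qed.

(** Describing dominoes by intervals between successive row ends turns the tiling property into a
    telescoping sum and the order of labels into monotonicity of [row_end]. *)
Lemma mem_domino_at (i j s : nat) :
  ((i, j) \in domino_cells (domino_at s)) = (row_end i s <= j < row_end i s.+1).
Proof.
have := surplus_le s; rewrite /domino_at.
case us: (u s); last case: eqP => [k0|/eqP k0] /=;
  rewrite /= !inE !xpair_eqE; case: i => [|[|i]] /=; rewrite ?us; lia.
Qed.

Lemma covered_before (i j s : nat) :
  j < row_end i s -> exists2 t, t < s & (i, j) \in domino_cells (domino_at t).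
Proof.
elim: s => [|s IHs]; first by case: i => [|[]].
case: (ltnP j (row_end i s)) => [/IHs[t lt_ts jt] _|le_j lt_j].
  by exists t => //; lia.
by exists s; rewrite // mem_domino_at le_j.
Qed.

Lemma nth_growth_shape (i s : nat) : nth 0 (growth_shape s) i = row_end i s.
Proof.
have kle := surplus_le s; rewrite /growth_shape /=.
by case: i => [|[|i]]; case: (ltnP 0 (s + _)); case: (ltnP 0 (s - _)) => /=;
  rewrite ?nth_nil; lia.
Qed.

Lemma growth_shape_partition (s : nat) : is_partition_of (2 * s) (growth_shape s).
Proof.
have kle := surplus_le s; rewrite /is_partition_of mem_filter /= /growth_shape /=.
by case: (ltnP 0 (s + _)); case: (ltnP 0 (s - _)) => /=; rewrite ?inE; lia.
Qed.

Lemma size_growth_shape (s : nat) : size (growth_shape s) <= 2.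
Proof. by rewrite size_filter (leq_trans (count_size _ _)). Qed.

Lemma domino_at_tiles (n : nat) :
  tiles (growth_shape n) [ffun s : 'I_n => domino_at s].
Proof.
apply/allP => -[i j] _ /=; apply/eqP.
rewrite count_mem_tiling (count_uniq_mem _ (diagram_uniq _)).
rewrite mem_diagram nth_growth_shape.
under eq_bigr do rewrite ffunE mem_domino_at.
elim: n => [|n IHn]; first by rewrite big_ord0; case: i => [|[]].
by rewrite big_ord_recr /= IHn; have := row_endS i n; lia.
Qed.

Lemma domino_at_increase (n : nat) :
  labels_increase [ffun s : 'I_n => domino_at s].
Proof.
apply/labels_increaseP => s t [i j] [i' j']; rewrite !ffunE !mem_domino_at.
move=> /andP[le_j _] /andP[_ lt_j']; rewrite leqNgt => bef.
(* If [t < s], then [j' < row_end i' s] while [row_end i s <= j]. This is absurd in a common row,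
   and also in a common column, as lower rows end earlier. *)
apply/negP => /(row_end_mono i') le_e; case/orP: bef => /andP[/= /eqP eq_ii' le_ii'].
  by subst i'; lia.
by have := row_end_anti s le_ii'; lia.
Qed.

Definition growth_tableau (n : nat) : B n :=
  exist _ (DominoTableau (growth_shape_partition n) (domino_at_tiles n)
             (domino_at_increase n)) (size_growth_shape n).

(** By strong induction, the smaller labels fill each row exactly up to [row_end]. The domino
    labelled [s] must take the first free cells of the rows it meets, which leaves only the choice
    recorded by [u s]. *)
Lemma domino_of_forced (n : nat) (T : B n) (s : 'I_n) :
  (forall t : 'I_n, u t = horizontal_in_first_row (domino_of (sval T) t)) ->
  domino_of (sval T) s = domino_at s.
Proof.
case: T => -[la f /= pla tl inc] /= sz uE.
have [m] := ubnP (s : nat); elim: m s => // m IHm s /ltnSE le_sm.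
have {IHm} IH (t : 'I_n) : t < s -> f t = domino_at t by move=> lt_ts; apply: IHm; lia.
have la1 : nth 0 la 1 <= nth 0 la 0.
  by case/and3P: pla; case: (la) => [|a [|b l]] //= /andP[].
have la2 i j : (i.+2, j) \notin domino_cells (f s).
  apply/negP => sj; have : j < nth 0 la i.+2 by apply/(tiles_cover _ _ tl); exists s.
  by rewrite nth_default //; lia.
have fresh i j : (i, j) \in domino_cells (f s) -> row_end i s <= j.
  move=> sj; rewrite leqNgt; apply/negP => /covered_before[t lt_ts tj].
  have lt_tn := ltn_trans lt_ts (ltn_ord s).
  rewrite -(IH (Ordinal lt_tn) lt_ts) in tj.
  by have /(congr1 val) /= := tiles_disjoint tl sj tj; lia.
(* A diagram cell outside the first [s] dominoes that is weakly before a cell of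
   the domino labelled [s] has a label at most [s], hence exactly [s]. *)
have before i j d : j < nth 0 la i -> d \in domino_cells (f s) ->
    weakly_before (i, j) d -> row_end i s <= j -> (i, j) \in domino_cells (f s).
  move=> /(tiles_cover _ _ tl)[t tj] sd bef le_j.
  have := labels_increaseP _ inc _ _ _ _ tj sd bef.
  rewrite leq_eqVlt => /orP[/eqP/val_inj <- //|lt_ts].
  move: tj; rewrite (IH t lt_ts) mem_domino_at => /andP[_].
  by have := row_end_mono i lt_ts; lia.
have inla i j : (i, j) \in domino_cells (f s) -> j < nth 0 la i.
  by move=> sj; apply/(tiles_cover _ _ tl); exists s.
have kles := surplus_le s.
move: (uE s) la2 fresh before inla; rewrite /domino_at.
case: (f s) => -[|[|i]] j /= -> la2 fresh before inla.
(* A free cell left of column [j] would belong to this domino by [before], so [j] is the row end. *)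
- have /= := fresh 0 j; rewrite inE eqxx => /(_ isT) le_j.
  have /= lt_j := inla 0 j; rewrite inE eqxx in lt_j.
  have /= := before 0 (s + surplus s) (0, j).
  rewrite !inE !xpair_eqE /weakly_before /= eqxx => h.
  by congr Horizontal; have := lt_j isT; lia.
(* The cell above [(1, j)] is outside this domino, hence already covered:
   [s - surplus s <= j < s + surplus s], so the surplus is positive. *)
- have /= := fresh 1 j; rewrite inE eqxx => /(_ isT) le_j.
  have /= lt_j := inla 1 j; rewrite inE eqxx in lt_j.
  have {}lt_j := lt_j isT.
  have /= := before 1 (s - surplus s) (1, j).
  rewrite !inE !xpair_eqE /weakly_before /= => h.
  have /= := before 0 j (1, j).
  rewrite !inE !xpair_eqE /weakly_before /= eqxx => h0.
  have -> : (surplus s == 0) = false by lia.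
  by congr Horizontal; lia.
- by have := la2 i j; rewrite inE eqxx.
(* Both cells are the first free ones of their rows, so [s + surplus s = j = s - surplus s] and the
   surplus is 0. *)
- have /= := fresh 0 j; rewrite inE eqxx => /(_ isT) le_j.
  have /= lt_j := inla 1 j; rewrite !inE eqxx orbT in lt_j.
  have {}lt_j := lt_j isT.
  have /= := before 0 (s + surplus s) (0, j).
  rewrite !inE !xpair_eqE /weakly_before /= => h.
  have /= := before 1 (s - surplus s) (1, j).
  rewrite !inE !xpair_eqE /weakly_before /= => h1.
  have -> : (surplus s == 0) = true by lia.
  by congr Vertical; lia.
- by have := la2 0 j; rewrite !inE eqxx orbT.
- by have := la2 i.+1 j; rewrite !inE eqxx orbT.
Qed.

Lemma tableau_shape_forced (n : nat) (T : B n) :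
  (forall t : 'I_n, u t = horizontal_in_first_row (domino_of (sval T) t)) ->
  tableau_shape (sval T) = growth_shape n.
Proof.
move=> uE; have dE s := domino_of_forced s uE; move: {uE} dE.
case: T => -[la f /= pla tl inc] /= sz dE.
have e i : nth 0 la i = row_end i n.
  suff h j : (j < nth 0 la i) = (j < row_end i n).
    by have := h (nth 0 la i); have := h (row_end i n); lia.
  apply/(tiles_cover _ _ tl)/idP => [[s]|/covered_before[t lt_tn tj]].
    rewrite dE mem_domino_at => /andP[_] lt_j.
    exact: leq_trans lt_j (row_end_mono i (ltn_ord s)).
  by exists (Ordinal lt_tn); rewrite dE.
by rewrite (two_row_shapeE pla sz) !e.
Qed.

End Growth.

(** * The inverse of [phi] *)

Lemma B_eq (n : nat) (T T' : B n) :
  tableau_shape (sval T) = tableau_shape (sval T') ->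
  domino_of (sval T) =1 domino_of (sval T') -> T = T'.
Proof.
case: T T' => -[la f p t i] sz [[la' f' p' t' i'] sz'] /= ela /ffunP ef.
subst la' f'; rewrite (bool_irrelevance p p') (bool_irrelevance t t') in sz *.
by rewrite (bool_irrelevance i i') in sz *; rewrite (bool_irrelevance sz sz').
Qed.

(** The reversal matches the one in [phi]; the domain is all of [nat] so that this can serve as
    [u]. *)
Definition up_label (w : seq step) (s : nat) : bool :=
  is_up (nth Down w (size w - s.+1)).

Lemma up_label_phi (n : nat) (T : B n) (s : 'I_n) :
  up_label (phi T) s = horizontal_in_first_row (domino_of (sval T) s).
Proof.
rewrite /up_label size_tuple -[X in nth _ _ X]/(rev_ord s : nat) -tnth_nth.
by rewrite tnth_mktuple rev_ordK inE; case: ifP.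
Qed.

Definition tableau_of_walk (n : nat) (w : D n) : B n :=
  growth_tableau (up_label w) n.

Lemma first_row_domino_at (u : nat -> bool) (s : nat) :
  horizontal_in_first_row (domino_at u s) = u s.
Proof. by rewrite /domino_at; case: (u s) => //; case: ifP. Qed.

Lemma phiK (n : nat) : cancel (@phi n) (@tableau_of_walk n).
Proof.
move=> T; apply: B_eq => /= [|s].
  by rewrite (tableau_shape_forced (@up_label_phi n T)).
by rewrite ffunE (domino_of_forced s (@up_label_phi n T)).
Qed.

Lemma tableau_of_walkK (n : nat) : cancel (@tableau_of_walk n) (@phi n).
Proof.
move=> w; apply: eq_from_tnth => j.
rewrite tnth_mktuple inE ffunE first_row_domino_at /up_label size_tuple.
rewrite -[X in nth _ _ X]/(rev_ord (rev_ord j) : nat) rev_ordK -tnth_nth.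
by case: (tnth w j).
Qed.

Lemma count_up_phi (n : nat) (T : B n) :
  count is_up (phi T) = #|first_row_labels T|.
Proof.
rewrite -sum1_count big_tuple -sum1_card (reindex_inj rev_ord_inj) /=.
apply: eq_bigl => j; rewrite tnth_mktuple rev_ordK.
by case: ifP.
Qed.

(** * Heights of walks *)

Definition walk_surplus (w : seq step) : nat :=
  foldr (fun x k => if is_up x then k.+1 else k.-1) 0 w.

(** The first [s] labels correspond to the last [s] steps, so adding a label prepends a step. *)
Lemma surplus_up_label (w : seq step) (s : nat) :
  s <= size w -> surplus (up_label w) s = walk_surplus (drop (size w - s) w).
Proof.
elim: s => [_|s IHs lt_s]; first by rewrite subn0 drop_size.
rewrite (drop_nth Down); last by lia.
by rewrite /= IHs ?(ltnW lt_s) // subnSK.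
Qed.

(** Stated on sequences to allow induction; [ordinate (take j w)] is convertible to
    [(vertex w j).2]. *)
Definition ordinate (w : seq step) : int := (\sum_(x <- w) step_vector x).2%R.

Lemma ordinate_cons (x : step) (w : seq step) :
  (ordinate (x :: w) = (if is_up x then 1 else -1) + ordinate w)%R.
Proof. by rewrite /ordinate big_cons; case: x. Qed.

Lemma ordinate_prefix_le (w : seq step) (j : nat) :
  (ordinate (take j w) <= (walk_surplus w)%:Z)%R.
Proof.
elim: w j => [|x w IHw] [|j]; rewrite /= ?take0; try by rewrite /ordinate big_nil.
by rewrite ordinate_cons; have := IHw j; case: (is_up x); lia.
Qed.

Lemma ordinate_prefix_attained (w : seq step) :
  exists2 j, j <= size w & ordinate (take j w) = (walk_surplus w)%:Z%R.
Proof.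
have nil0 : ordinate [::] = 0%R by rewrite /ordinate big_nil.
elim: w => [|x w [j le_j jE]] /=; first by exists 0.
(* The tested value is 0 only for a down step before a walk of maximum 0, where truncation occurs
   and the starting vertex is highest. Otherwise the best prefix of [w] is extended by [x]. *)
have [k0|k0] := eqVneq (if is_up x then 1 else walk_surplus w) 0.
  by exists 0; move: k0; case: (is_up x) => // ->.
exists j.+1 => //=; rewrite ordinate_cons jE.
by move: k0; case: (is_up x); lia.
Qed.

Lemma height_surplus (n : nat) (w : D n) :
  height w = (surplus (up_label w) n)%:Z%R.
Proof.
have -> : surplus (up_label w) n = walk_surplus w.
  by have := @surplus_up_label w n; rewrite size_tuple subnn drop0; apply.
apply/le_anti/andP; split.
  by apply: bigmax_le => // j _; apply: ordinate_prefix_le.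
have [j] := ordinate_prefix_attained w; rewrite size_tuple -ltnS => lt_j <-.
exact: (le_bigmax_cond _ (fun j : 'I_n.+1 => (vertex w j).2) (j := Ordinal lt_j)).
Qed.

Lemma phi_shape (n : nat) (T : B n) :
  tableau_shape (sval T) = growth_shape (up_label (phi T)) n.
Proof. exact/tableau_shape_forced/up_label_phi. Qed.

Theorem theorem2p6 (n : nat) (n_ge1 : 1 <= n) :
  bijective (@phi n) /\
  forall T : B n,
    [/\ forall k : nat,
          #|first_row_labels T| = k <-> count is_up (phi T) = k,
        (has_two_rows T /\ equal_columns T) <-> height (phi T) = 0%R
      & forall k : nat, k <= n ->
          (has_shape T (n + k) (n - k) <-> height (phi T) = k%:Z%R)].
Proof.
split; first by exists (@tableau_of_walk n); [apply: phiK|apply: tableau_of_walkK].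
move=> T; have kle := surplus_le (up_label (phi T)) n.
rewrite count_up_phi height_surplus /has_shape /has_two_rows /equal_columns phi_shape.
rewrite /growth_shape; move: (surplus _ n) kle => k kle; split=> //.
- rewrite /=; have -> : 0 < n + k by lia.
  (* When [n - k = 0] the shape is a single row: its columns are all equal, yet the height is
     [n > 0]. [has_two_rows] excludes this case. *)
  case: (ltnP 0 (n - k)) => [k_lt|k_ge] /=; last by split=> [[]|[]] //; lia.
  split=> [[_ cols]|[->]].
    (* The first column has size 2, and the last one does only if [n + k <= n - k]. *)
    have := cols 0 (n + k).-1; rewrite /column_size /=; lia.
  split=> // j j' lt_j lt_j'; rewrite /column_size /=; lia.
- move=> l le_l; rewrite /=; have -> : 0 < n + k by lia.
  have -> : 0 < n + l by lia.
  split=> [[]|[->] //]; lia.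
Qed.
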